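(* If $G$ is a graph, then $\gamma(G)\le \iota(G\,\Box\, K_2)\le \gamma(G\,\Box\, K_2)$. In addition, if $G$ is bipartite, then $\iota(G\,\Box\, K_2)=\gamma(G)$.
   Context: All graphs are finite and simple; $\Box$ is the Cartesian product and $\gamma$ the domination number. A set $A$ of vertices is isolating if no two vertices outside the closed neighborhood $N[A]$ are adjacent; $\iota$ is the minimum size of an isolating set. *)

(* Defs.v *)
From mathcomp Require Import all_boot.

Set Implicit Arguments.
Unset Strict Implicit.
Unset Printing Implicit Defensive.

Record sgraph := SGraph {
  svertex :> finType;
  sedge : rel svertex;
  sedge_sym : symmetric sedge;
  sedge_irrefl : irreflexive sedge
}.

Section Box.
Variables G H : sgraph.

Definition box_rel : rel (svertex G * svertex H) := fun x y =>
  ((x.1 == y.1) && sedge x.2 y.2) || ((x.2 == y.2) && sedge x.1 y.1).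

Lemma box_rel_sym : symmetric box_rel.
Proof.
by move=> x y; rewrite /box_rel [x.1 == _]eq_sym [x.2 == _]eq_sym
  [sedge x.1 _]sedge_sym [sedge x.2 _]sedge_sym.
Qed.

Lemma box_rel_irrefl : irreflexive box_rel.
Proof. by move=> x; rewrite /box_rel !sedge_irrefl !andbF. Qed.

Definition box : sgraph := SGraph box_rel_sym box_rel_irrefl.

End Box.

Section Complete.
Variable n : nat.

Definition complete_rel : rel 'I_n := fun i j => i != j.

Lemma complete_rel_sym : symmetric complete_rel.
Proof. by move=> i j; rewrite /complete_rel eq_sym. Qed.

Lemma complete_rel_irrefl : irreflexive complete_rel.
Proof. by move=> i; rewrite /complete_rel eqxx. Qed.

Definition complete : sgraph := SGraph complete_rel_sym complete_rel_irrefl.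

End Complete.

Section Invariants.
Variable G : sgraph.
Implicit Types A : {set G}.

Definition closed_nbhd A : {set G} :=
  [set v | [exists u in A, (u == v) || sedge u v]].

Definition dominating A : bool := closed_nbhd A == [set: G].

Definition independent A : bool :=
  [forall x in A, forall y in A, ~~ sedge x y].

Definition isolating A : bool := independent (~: closed_nbhd A).

Lemma closed_nbhdT : closed_nbhd [set: G] = [set: G].
Proof.
apply/setP=> v; rewrite !inE.
by apply/existsP; exists v; rewrite inE eqxx.
Qed.

Lemma dominatingT : dominating [set: G].
Proof. by rewrite /dominating closed_nbhdT. Qed.

Lemma isolatingT : isolating [set: G].
Proof.
by rewrite /isolating closed_nbhdT setCT; apply/forall_inP=> x; rewrite inE.
Qed.

(* By [dominatingT] and [isolatingT], the whole vertex set is a valid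
   starting point, so the minima below range over nonempty families. *)
Definition domination_number : nat :=
  #|[arg min_(A < [set: G] | dominating A) #|A|]|.

Definition isolation_number : nat :=
  #|[arg min_(A < [set: G] | isolating A) #|A|]|.

Definition bipartite : Prop :=
  exists A : {set G}, independent A /\ independent (~: A).

End Invariants.

(* Main.v *)
Require Import Defs.
From mathcomp Require Import all_boot.

Set Implicit Arguments.
Unset Strict Implicit.
Unset Printing Implicit Defensive.

(** Let [A] be isolating in the prism of [G]. Each vertex [v] of [G] gives an
    edge [(v,0)(v,1)], one end of which lies in [N[A]], so [v] is dominated by
    the projection of [A]; hence the projection dominates [G].  Conversely, lift
    a dominating set [D] of a bipartite [G] along a proper 2-colouring [c], each
    [u] in [D] going to [(u, c u)]. A neighbour [w] of [u] has the other colour,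
    so [(w, c u)] is dominated, and every undominated vertex has the form
    [(w, c w)]. Such vertices are pairwise nonadjacent. *)

Lemma closed_nbhdP (G : sgraph) (A : {set G}) (v : G) :
  reflect (exists2 u, u \in A & u = v \/ sedge u v) (v \in closed_nbhd A).
Proof.
rewrite inE; apply: (iffP exists_inP) => -[u uA uv]; exists u => //.
  by case/orP: uv => [/eqP|]; [left|right].
by case: uv => [->|->]; rewrite ?eqxx ?orbT.
Qed.

Lemma dominatingP (G : sgraph) (A : {set G}) :
  reflect (forall v, v \in closed_nbhd A) (dominating A).
Proof.
apply: (iffP eqP) => [-> v|domA]; first exact: in_setT.
by apply/setP=> v; rewrite domA in_setT.
Qed.

Lemma independentP (G : sgraph) (A : {set G}) :
  reflect {in A &, forall x y, ~~ sedge x y} (independent A).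
Proof.
apply: (iffP forall_inP) => [indA x y xA yA|indA x xA].
  exact: (forall_inP (indA x xA)).
by apply/forall_inP=> y; apply: indA.
Qed.

Lemma domination_number_min (G : sgraph) (A : {set G}) :
  dominating A -> domination_number G <= #|A|.
Proof.
rewrite /domination_number.
by case: arg_minnP => [|B _ minB]; [exact: dominatingT|exact: minB].
Qed.

Lemma domination_number_ex (G : sgraph) :
  exists2 A : {set G}, dominating A & #|A| = domination_number G.
Proof.
rewrite /domination_number.
by case: arg_minnP => [|B domB _]; [exact: dominatingT|exists B].
Qed.

Lemma isolation_number_min (G : sgraph) (A : {set G}) :
  isolating A -> isolation_number G <= #|A|.
Proof.
rewrite /isolation_number.
by case: arg_minnP => [|B _ minB]; [exact: isolatingT|exact: minB].
Qed.

Lemma isolation_number_ex (G : sgraph) :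
  exists2 A : {set G}, isolating A & #|A| = isolation_number G.
Proof.
rewrite /isolation_number.
by case: arg_minnP => [|B isoB _]; [exact: isolatingT|exists B].
Qed.

Lemma dominating_isolating (G : sgraph) (A : {set G}) :
  dominating A -> isolating A.
Proof.
move=> /dominatingP domA; apply/independentP => x y.
by rewrite in_setC domA.
Qed.

Lemma isolation_le_domination (G : sgraph) :
  isolation_number G <= domination_number G.
Proof.
have [A domA <-] := domination_number_ex G.
exact/isolation_number_min/dominating_isolating.
Qed.

(** An edge of the product projects either to an edge of [G] or to a single vertex, and both are
    allowed in a closed neighborhood. *)
Lemma closed_nbhd_box_fst (G H : sgraph) (A : {set box G H}) (x : box G H) :
  x \in closed_nbhd A -> x.1 \in closed_nbhd [set u.1 | u in A].
Proof.
case/closed_nbhdP => u uA ux; apply/closed_nbhdP; exists u.1.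
  exact: imset_f.
case: ux => [->|/orP[/andP[/eqP-> _]|/andP[_]]]; by [left|right].
Qed.

(** One edge [ab] of [H] is enough: the copies of [v] in layers [a] and [b] are adjacent, so they
    cannot both escape [closed_nbhd A]. *)
Lemma isolating_box_fst (G H : sgraph) (A : {set box G H}) (a b : H) :
  sedge a b -> isolating A -> dominating [set u.1 | u in A].
Proof.
move=> ab /independentP isoA; apply/dominatingP => v.
have [|va] := boolP ((v, a) \in closed_nbhd A).
  exact: closed_nbhd_box_fst.
have [|vb] := boolP ((v, b) \in closed_nbhd A).
  exact: closed_nbhd_box_fst.
have /negP[] : ~~ sedge ((v, a) : box G H) (v, b).
  by apply: isoA; rewrite in_setC.
by rewrite /= /box_rel /= eqxx ab.
Qed.

Lemma domination_le_isolation_box (G H : sgraph) (a b : H) :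
  sedge a b -> domination_number G <= isolation_number (box G H).
Proof.
move=> ab; have [A isoA <-] := isolation_number_ex (box G H).
(* Projecting may merge vertices but never increases their number. *)
apply: leq_trans (leq_imset_card (fun u => u.1) A).
exact/domination_number_min/(isolating_box_fst ab).
Qed.

Lemma bipartite_coloring (G : sgraph) :
  bipartite G -> exists c : G -> 'I_2, forall x y, sedge x y -> c x != c y.
Proof.
case=> X [/independentP indX /independentP indXC].
exists (fun v => if v \in X then ord0 else ord_max) => x y xy.
have [xX|xX] := boolP (x \in X); have [yX|yX] := boolP (y \in X) => //.
  by rewrite (negbTE (indX x y xX yX)) in xy.
by rewrite (negbTE (indXC x y _ _)) ?in_setC in xy.
Qed.

(** With two colours, only one value differs from [j]. *)
Lemma ord2_neq_trans (i j k : 'I_2) : i != j -> j != k -> i = k.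
Proof.
by case: i j k => [[|[|i]] ?] [[|[|j]] ?] [[|[|k]] ?] // _ _; apply: val_inj.
Qed.

Lemma isolating_coloring_lift (G : sgraph) (c : G -> 'I_2) (D : {set G}) :
  (forall x y, sedge x y -> c x != c y) -> dominating D ->
  isolating ([set (u, c u) | u in D] : {set box G (complete 2)}).
Proof.
move=> proper_c /dominatingP domD; set A : {set box G (complete 2)} := imset _ _.
have undominated (x : box G (complete 2)) :
    x \in ~: closed_nbhd A -> x.2 = c x.1.
  rewrite in_setC; apply: contraNeq; case: x => w i /= ciw.
  have /closed_nbhdP[u uD uw] := domD w.
  apply/(@closed_nbhdP (box G (complete 2))); exists (u, c u).
    exact: imset_f.
  (* The lift of [u] is adjacent to [(w, i)] in either case: along the [K_2] edge over [w] if
     [u = w], and otherwise inside layer [i], since [c u] and [i] both differ from [c w]. *)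
  right; rewrite /= /box_rel /= /complete_rel.
  case: uw => [->|uw]; first by rewrite eqxx eq_sym ciw.
  have -> : c u = i by apply: ord2_neq_trans (proper_c _ _ uw) _; rewrite eq_sym.
  by rewrite eqxx uw orbT.
apply/independentP => x y /undominated xc /undominated yc.
rewrite /= /box_rel /= /complete_rel xc yc.
(* An edge over a single vertex would need two colours there; an edge within a layer would join
   neighbours of equal colour. *)
apply/norP; split; apply/andP => -[/eqP exy]; first by rewrite exy eqxx.
by move/proper_c; rewrite exy eqxx.
Qed.

Theorem theorem3p7 (G : sgraph) :
  (domination_number G <= isolation_number (box G (complete 2))
     <= domination_number (box G (complete 2))) /\
  (bipartite G ->
     isolation_number (box G (complete 2)) = domination_number G).
Proof.
have lower : domination_number G <= isolation_number (box G (complete 2)).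
  by apply: (@domination_le_isolation_box _ (complete 2) ord0 ord_max).
split; first by rewrite lower isolation_le_domination.
case/bipartite_coloring => c proper_c.
apply/eqP; rewrite eqn_leq lower andbT.
have [D domD <-] := domination_number_ex G.
(* The lift takes one vertex per element of [D], so it is no larger than [D]. *)
apply: leq_trans (leq_imset_card (fun u => (u, c u)) D).
exact/isolation_number_min/isolating_coloring_lift.
Qed.
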